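(* Let $\mathcal{C}$ be a weakly fiat $2$-category over an algebraically closed field, let $C$ be a coalgebra $1$-morphism in $\underline{\mathcal{C}}$, and let $\iota:D\hookrightarrow C$ be a subcoalgebra. Then the fully faithful embedding $-\square_D D_C$ sends $\mathrm{comod}_{\underline{\mathcal{C}}}(D)$ to a Serre subcategory of $\mathrm{comod}_{\underline{\mathcal{C}}}(C)$ if, and only if, $D$ is coidempotent.
   Context: A $\Bbbk$-linear category ($\Bbbk$ an algebraically closed field) is finitary if it is additive, idempotent complete, has finitely many isomorphism classes of indecomposable objects and finite-dimensional morphism spaces. A finitary $2$-category $\mathcal{C}$ has finitely many objects, finitary $\Bbbk$-linear morphism categories, biadditive and bilinear horizontal composition, and indecomposable identity $1$-morphisms $\mathbb{1}_{\mathtt{i}}$. It is weakly fiat if it has a weak anti-equivalence $(-)^*$ reversing the direction of $1$- and $2$-morphisms such that $(F,F^* )$ is an adjoint pair for each $1$-morphism $F$. Horizontal and vertical composition are $\circ_0,\circ_1$; horizontal composition of $1$-morphisms is written by juxtaposition (non-composable composites being zero). $\underline{\mathcal{C}}$ is the injective abelianisation of $\mathcal{C}$: each $\underline{\mathcal{C}}(\mathtt{i},\mathtt{j})$ is the abelian category with enough injectives in which $\mathcal{C}(\mathtt{i},\mathtt{j})$ is (up to equivalence) the full subcategory of injective objects. Horizontal composition extends to $\underline{\mathcal{C}}$ and is left exact in both variables. A coalgebra $1$-morphism $C$ in $\underline{\mathcal{C}}$ is a coalgebra object in $\coprod_{\mathtt{i}}\underline{\mathcal{C}}(\mathtt{i},\mathtt{i})$,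 i.e. a direct sum of $1$-morphisms there with $2$-morphisms $\mu_C:C\to CC$, $\varepsilon_C:C\to\mathbb{1}=\bigoplus_{\mathtt{i}}\mathbb{1}_{\mathtt{i}}$ satisfying coassociativity and counitality. A right $C$-comodule is a $1$-morphism $M$ of $\underline{\mathcal{C}}$ with a coassociative, counital $\rho_M:M\to MC$; left comodules and bicomodules are analogous. $M\square_C N$ is the kernel of $\rho_M\circ_0\mathrm{id}_N-\mathrm{id}_M\circ_0\lambda_N:MN\to MCN$. $\mathrm{comod}_{\underline{\mathcal{C}}}(C)$ is the category of right $C$-comodules in $\underline{\mathcal{C}}$. A subcoalgebra of $C$ is a coalgebra $1$-morphism $D$ with a monomorphism $\iota:D\hookrightarrow C$ in $\underline{\mathcal{C}}$ such that $\mu_C\circ_1\iota=(\iota\circ_0\iota)\circ_1\mu_D$ and $\varepsilon_D=\varepsilon_C\circ_1\iota$. The functor $-\square_D D_C$ sends a right $D$-comodule $(N,\rho)$ to the right $C$-comodule $(N,(\mathrm{id}_N\circ_0\iota)\circ_1\rho)$. $D$ is coidempotent if $\mu_C^{-1}(CD+DC)=D$; equivalently, with $J=C/D$ (cokernel of $\iota$), $\pi_J:C\to J$ the projection and $\rho_J$ the right $C$-coaction of $J$, the map $\mu_J:=(\mathrm{id}_J\circ_0\pi_J)\circ_1\rho_J:J\to JJ$ is a monomorphism in $\underline{\mathcal{C}}$. ''Sends to a Serre subcategory'' means that the essential image is closed under subobjects, quotients and extensions. *)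

(* Defs.v *)
From HB Require Import structures.
From mathcomp Require Import all_boot all_algebra.

Set Implicit Arguments.
Unset Strict Implicit.
Unset Printing Implicit Defensive.

Import GRing.Theory.
Local Open Scope ring_scope.

Declare Scope cat_scope.
Delimit Scope cat_scope with cat.
Local Open Scope cat_scope.

Reserved Notation "g \c f" (at level 45, left associativity).
Reserved Notation "F ** G" (at level 40, left associativity).
Reserved Notation "f *** g" (at level 40, left associativity).

Record lincat (k : fieldType) := LinCat {
  ob :> Type;
  hom : ob -> ob -> lmodType k;
  idm : forall x, hom x x;
  comp : forall x y z, hom y z -> hom x y -> hom x z;
  compA : forall x y z t (h : hom z t) (g : hom y z) (f : hom x y),
    comp h (comp g f) = comp (comp h g) f;
  comp1m : forall x y (f : hom x y), comp (idm y) f = f;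
  compm1 : forall x y (f : hom x y), comp f (idm x) = f;
  comp_linr : forall x y z (g : hom y z), linear (fun f : hom x y => comp g f);
  comp_linl : forall x y z (f : hom x y), linear (fun g : hom y z => comp g f)
}.

Arguments hom {k} {l} x y.
Arguments idm {k} {l} x.
Arguments comp {k} {l} {x y z} g f.
Notation "g \c f" := (comp g f) : cat_scope.

Section LinCat.
Variables (k : fieldType) (A : lincat k).

Lemma linear_at0 (U V : lmodType k) (f : U -> V) : linear f -> f 0 = 0.
Proof. by move=> /(_ (-1) 0 0); rewrite scaler0 addr0 scaleN1r addNr. Qed.

Lemma compm0 (x y z : A) (g : hom y z) : g \c (0 : hom x y) = 0.
Proof. exact: linear_at0 (comp_linr g). Qed.

Lemma comp0m (x y z : A) (f : hom x y) : (0 : hom y z) \c f = 0.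
Proof. exact: linear_at0 (comp_linl f). Qed.

Implicit Types x y z : A.

Record iso x y := Iso {
  fwd : hom x y;
  bwd : hom y x;
  bwdK : bwd \c fwd = idm x;
  fwdK : fwd \c bwd = idm y
}.

Definition isomorphic x y : Prop := inhabited (iso x y).

Definition mono x y (f : hom x y) : Prop :=
  forall z (g h : hom z x), f \c g = f \c h -> g = h.

Definition epi x y (f : hom x y) : Prop :=
  forall z (g h : hom y z), g \c f = h \c f -> g = h.

Definition is_kernel x y (f : hom x y) w (m : hom w x) : Prop :=
  f \c m = 0 /\
  forall z (h : hom z x), f \c h = 0 -> exists! u : hom z w, m \c u = h.

Definition is_cokernel x y (f : hom x y) w (p : hom y w) : Prop :=
  p \c f = 0 /\
  forall z (h : hom y z), h \c f = 0 -> exists! u : hom w z, u \c p = h.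

(* 0 -> x -> y -> z -> 0 *)
Definition short_exact x y z (f : hom x y) (g : hom y z) : Prop :=
  is_kernel g f /\ is_cokernel f g.

Definition is_zero x : Prop := idm x = 0.

Definition is_biproduct x y s : Prop :=
  exists (i1 : hom x s) (i2 : hom y s) (p1 : hom s x) (p2 : hom s y),
    [/\ p1 \c i1 = idm x, p2 \c i2 = idm y, p1 \c i2 = 0, p2 \c i1 = 0
      & i1 \c p1 + i2 \c p2 = idm s].

Definition indecomposable x : Prop :=
  ~ is_zero x /\ forall y z, is_biproduct y z x -> is_zero y \/ is_zero z.

Definition injective_object x : Prop :=
  forall y z (m : hom y z), mono m ->
  forall f : hom y x, exists g : hom z x, g \c m = f.

Definition idto x y (e : x = y) : hom x y :=
  match e in _ = t return hom x t with erefl => idm x end.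

End LinCat.

Section CatProperties.
Variables (k : fieldType) (A : lincat k).

Definition additive_cat : Prop :=
  (exists z : A, is_zero z) /\
  forall x y : A, exists s, is_biproduct x y s.

Definition idempotent_complete : Prop :=
  forall (x : A) (e : hom x x), e \c e = e ->
  exists (y : A) (r : hom x y) (s : hom y x), r \c s = idm y /\ s \c r = e.

Definition finitely_many_indecomposables : Prop :=
  exists (n : nat) (X : 'I_n -> A),
  forall x : A, indecomposable x -> exists a, isomorphic x (X a).

Definition finite_dim_homs : Prop :=
  forall x y : A, exists (n : nat) (b : 'I_n -> hom x y),
  forall f : hom x y, exists c : 'I_n -> k, f = \sum_(a < n) c a *: b a.

Definition finitary_cat : Prop :=
  [/\ additive_cat, idempotent_complete, finitely_many_indecomposables
    & finite_dim_homs].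

Definition abelian_cat : Prop :=
  [/\ additive_cat,
      forall (x y : A) (f : hom x y), exists w (m : hom w x), is_kernel f m,
      forall (x y : A) (f : hom x y), exists w (p : hom y w), is_cokernel f p,
      forall (x y : A) (m : hom x y), mono m ->
        exists w (g : hom y w), is_kernel g m
    & forall (x y : A) (p : hom x y), epi p ->
        exists w (g : hom w x), is_cokernel g p].

Definition enough_injectives : Prop :=
  forall x : A, exists (e : A) (m : hom x e), injective_object e /\ mono m.

Definition serre (S : A -> Prop) : Prop :=
  [/\ forall (x y : A) (m : hom x y), mono m -> S y -> S x,
      forall (x y : A) (p : hom x y), epi p -> S x -> S y
    & forall (x y z : A) (f : hom x y) (g : hom y z),
        short_exact f g -> S x -> S z -> S y].

End CatProperties.

Definition opcat (k : fieldType) (A : lincat k) : lincat k :=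
  @LinCat k A (fun x y => hom y x) (fun x => idm x) (fun x y z g f => f \c g)
    (fun x y z t h g f => esym (compA f g h))
    (fun x y f => compm1 f) (fun x y f => comp1m f)
    (fun x y z g => @comp_linl k A z y x g)
    (fun x y z f => @comp_linr k A z y x f).

Record linfun k (A B : lincat k) := LinFun {
  fob :> A -> B;
  fmap : forall x y, hom x y -> hom (fob x) (fob y);
  fmap1 : forall x, fmap (idm x) = idm (fob x);
  fmapM : forall x y z (g : hom y z) (f : hom x y),
    fmap (g \c f) = fmap g \c fmap f;
  fmap_lin : forall x y, linear (@fmap x y)
}.

Arguments fmap {k A B} l {x y} f.

Section Functors.
Variables (k : fieldType) (A B : lincat k) (T : linfun A B).

Definition fully_faithful : Prop :=
  forall x y : A, bijective (fmap T : hom x y -> hom (T x) (T y)).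

Definition ess_image (y : B) : Prop := exists x : A, isomorphic (T x) y.

Definition equivalence : Prop := fully_faithful /\ forall y, ess_image y.

Definition left_exact : Prop :=
  forall (x y : A) (f : hom x y) w (m : hom w x),
    is_kernel f m -> is_kernel (fmap T f) (fmap T m).

End Functors.

(* The objects are the elements of [I]; [B i j] is the category of 1-morphisms
   from [i] to [j], and [F ** G] is "[F] after [G]". *)

Record bicat (k : fieldType) (I : Type) := Bicat {
  onecat :> I -> I -> lincat k;
  id1 : forall i, onecat i i;
  hc : forall i j l, onecat j l -> onecat i j -> onecat i l;
  hc2 : forall i j l (F F' : onecat j l) (G G' : onecat i j),
    hom F F' -> hom G G' -> hom (hc F G) (hc F' G');
  hc2_id : forall i j l (F : onecat j l) (G : onecat i j),
    hc2 (idm F) (idm G) = idm (hc F G);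
  hc2_comp : forall i j l (F F' F'' : onecat j l) (G G' G'' : onecat i j)
    (f' : hom F' F'') (f : hom F F') (g' : hom G' G'') (g : hom G G'),
    hc2 (f' \c f) (g' \c g) = hc2 f' g' \c hc2 f g;
  hc2_linl : forall i j l (F F' : onecat j l) (G G' : onecat i j)
    (g : hom G G'), linear (fun f : hom F F' => hc2 f g);
  hc2_linr : forall i j l (F F' : onecat j l) (G G' : onecat i j)
    (f : hom F F'), linear (fun g : hom G G' => hc2 f g);
  asc : forall i j l m (F : onecat l m) (G : onecat j l) (H : onecat i j),
    iso (hc (hc F G) H) (hc F (hc G H));
  asc_nat : forall i j l m (F F' : onecat l m) (G G' : onecat j l)
    (H H' : onecat i j) (f : hom F F') (g : hom G G') (h : hom H H'),
    fwd (asc F' G' H') \c hc2 (hc2 f g) h =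
    hc2 f (hc2 g h) \c fwd (asc F G H);
  lun : forall i j (F : onecat i j), iso (hc (id1 j) F) F;
  lun_nat : forall i j (F F' : onecat i j) (f : hom F F'),
    fwd (lun F') \c hc2 (idm (id1 j)) f = f \c fwd (lun F);
  run : forall i j (F : onecat i j), iso (hc F (id1 i)) F;
  run_nat : forall i j (F F' : onecat i j) (f : hom F F'),
    fwd (run F') \c hc2 f (idm (id1 i)) = f \c fwd (run F);
  pentagon : forall i j l m n (F : onecat m n) (G : onecat l m)
    (H : onecat j l) (K : onecat i j),
    fwd (asc F G (hc H K)) \c fwd (asc (hc F G) H K) =
    hc2 (idm F) (fwd (asc G H K)) \c fwd (asc F (hc G H) K)
      \c hc2 (fwd (asc F G H)) (idm K);
  triangle : forall i j l (F : onecat j l) (G : onecat i j),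
    hc2 (idm F) (fwd (lun G)) \c fwd (asc F (id1 j) G) =
    hc2 (fwd (run F)) (idm G)
}.

Arguments id1 {k I} b i.
Arguments hc {k I} {b} {i j l} F G.
Arguments hc2 {k I} {b} {i j l} {F F' G G'} f g.
Arguments asc {k I} {b} {i j l m} F G H.
Arguments lun {k I} {b} {i j} F.
Arguments run {k I} {b} {i j} F.
Notation "F ** G" := (hc F G) : cat_scope.
Notation "f *** g" := (hc2 f g) : cat_scope.

Section Bicat.
Variables (k : fieldType) (I : Type) (B : bicat k I).

Lemma lwhisk1 i j l (M : B j l) (x : B i j) :
  idm M *** idm x = idm (M ** x).
Proof. exact: hc2_id. Qed.

Lemma lwhiskM i j l (M : B j l) (x y z : B i j) (g : hom y z) (f : hom x y) :
  idm M *** (g \c f) = (idm M *** g) \c (idm M *** f).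
Proof. by rewrite -hc2_comp comp1m. Qed.

Lemma rwhiskM i j l (N : B i j) (x y z : B j l) (g : hom y z) (f : hom x y) :
  (g \c f) *** idm N = (g *** idm N) \c (f *** idm N).
Proof. by rewrite -hc2_comp comp1m. Qed.

Definition lwhisk i j l (M : B j l) : linfun (B i j) (B i l) :=
  @LinFun k (B i j) (B i l) (fun x => M ** x) (fun x y f => idm M *** f)
    (fun x => hc2_id M x) (fun x y z g f => lwhiskM M g f)
    (fun x y => @hc2_linr k I B i j l M M x y (idm M)).

Definition rwhisk i j l (N : B i j) : linfun (B j l) (B i l) :=
  @LinFun k (B j l) (B i l) (fun x => x ** N) (fun x y f => f *** idm N)
    (fun x => hc2_id x N) (fun x y z g f => rwhiskM N g f)
    (fun x y => @hc2_linl k I B i j l x y N N (idm N)).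

Definition hc_left_exact : Prop :=
  (forall i j l (M : B j l), left_exact (@lwhisk i j l M)) /\
  (forall i j l (N : B i j), left_exact (@rwhisk i j l N)).

Definition strict : Prop :=
  [/\ forall i j l m (F : B l m) (G : B j l) (H : B i j),
        exists e : (F ** G) ** H = F ** (G ** H), fwd (asc F G H) = idto e,
      forall i j (F : B i j),
        exists e : id1 B j ** F = F, fwd (lun F) = idto e
    & forall i j (F : B i j),
        exists e : F ** id1 B i = F, fwd (run F) = idto e].

(* [F] is left adjoint to [G]. *)
Definition adjoint_pair i j (F : B i j) (G : B j i) : Prop :=
  exists (eta : hom (id1 B i) (G ** F)) (eps : hom (F ** G) (id1 B j)),
    fwd (lun F) \c (eps *** idm F) \c bwd (asc F G F) \c (idm F *** eta)
      \c bwd (run F) = idm F /\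
    fwd (run G) \c (idm G *** eps) \c fwd (asc G F G) \c (eta *** idm G)
      \c bwd (lun G) = idm G.

End Bicat.

(* Both 1- and 2-morphisms are reversed. *)
Section Coop.
Variables (k : fieldType) (I : Type) (B : bicat k I).

Definition op_iso (A : lincat k) (x y : A) (f : iso x y) :
    @iso k (opcat A) x y :=
  @Iso k (opcat A) x y (bwd f) (fwd f) (bwdK f) (fwdK f).

Definition op_iso_inv (A : lincat k) (x y : A) (f : iso x y) :
    @iso k (opcat A) y x :=
  @Iso k (opcat A) y x (fwd f) (bwd f) (fwdK f) (bwdK f).

Lemma bwd_nat (A : lincat k) (x y x' y' : A) (a : iso x y) (a' : iso x' y')
    (f : hom x x') (g : hom y y') :
  fwd a' \c f = g \c fwd a -> f \c bwd a = bwd a' \c g.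
Proof.
move=> E; rewrite -[LHS]comp1m -(bwdK a') -compA (compA (fwd a')) E.
by rewrite -(compA g) fwdK compm1.
Qed.

Definition coop : bicat k I.
Proof.
refine (@Bicat k I (fun i j => opcat (B j i)) (id1 B)
  (fun i j l F G => G ** F)
  (fun i j l F F' G G' f g => g *** f) _ _ _ _
  (fun i j l m F G H => op_iso_inv (asc H G F)) _
  (fun i j F => op_iso (run F)) _
  (fun i j F => op_iso (lun F)) _ _ _).
- by move=> i j l F G /=; apply: hc2_id.
- by move=> i j l F F' F'' G G' G'' f' f g' g /=; apply: hc2_comp.
- by move=> i j l F F' G G' g; apply: (@hc2_linr k I B).
- by move=> i j l F F' G G' f; apply: (@hc2_linl k I B).
- by move=> i j l m F F' G G' H H' f g h /=; rewrite asc_nat.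
- by move=> i j F F' f /=; apply/bwd_nat/run_nat.
- by move=> i j F F' f /=; apply/bwd_nat/lun_nat.
- by move=> i j l m n F G H K /=; rewrite pentagon compA.
move=> i j l F G /=.
have E := triangle G F.
have lK : (idm G *** bwd (lun F)) \c (idm G *** fwd (lun F)) =
    idm (G ** (id1 B j ** F)) by rewrite -hc2_comp bwdK comp1m hc2_id.
rewrite -[LHS]comp1m -lK -!compA (compA (idm G *** fwd (lun F))) E -hc2_comp.
by rewrite fwdK comp1m hc2_id compm1.
Defined.

End Coop.

Record pseudofunctor k I (B B' : bicat k I) := PseudoFunctor {
  pf1 :> forall i j, linfun (B i j) (B' i j);
  pfM : forall i j l (F : B j l) (G : B i j),
    iso (pf1 j l F ** pf1 i j G) (pf1 i l (F ** G));
  pfM_nat : forall i j l (F F' : B j l) (G G' : B i j)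
    (f : hom F F') (g : hom G G'),
    fwd (pfM F' G') \c (fmap (pf1 j l) f *** fmap (pf1 i j) g) =
    fmap (pf1 i l) (f *** g) \c fwd (pfM F G);
  pfU : forall i, iso (id1 B' i) (pf1 i i (id1 B i));
  pf_asc : forall i j l m (F : B l m) (G : B j l) (H : B i j),
    fmap (pf1 i m) (fwd (asc F G H)) \c fwd (pfM (F ** G) H)
      \c (fwd (pfM F G) *** idm (pf1 i j H)) =
    fwd (pfM F (G ** H)) \c (idm (pf1 l m F) *** fwd (pfM G H))
      \c fwd (asc (pf1 l m F) (pf1 j l G) (pf1 i j H));
  pf_lun : forall i j (F : B i j),
    fmap (pf1 i j) (fwd (lun F)) \c fwd (pfM (id1 B j) F)
      \c (fwd (pfU j) *** idm (pf1 i j F)) = fwd (lun (pf1 i j F));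
  pf_run : forall i j (F : B i j),
    fmap (pf1 i j) (fwd (run F)) \c fwd (pfM F (id1 B i))
      \c (idm (pf1 i j F) *** fwd (pfU i)) = fwd (run (pf1 i j F))
}.

Section Fiat.
Variables (k : fieldType) (I : finType).

Definition finitary_2cat (C : bicat k I) : Prop :=
  [/\ strict C, forall i j, finitary_cat (C i j)
    & forall i, indecomposable (id1 C i)].

(* An adjoint of [F : i -> j] goes from [j] to [i], so the anti-equivalence
   is the identity on objects, and it is an equivalence as soon as it is one
   on all categories of 1-morphisms. *)
Definition weakly_fiat (C : bicat k I) : Prop :=
  finitary_2cat C /\
  exists S : pseudofunctor C (coop C),
    (forall i j, equivalence (S i j)) /\
    forall i j (F : C i j), adjoint_pair F (S i j F : C j i).

(* The injective abelianisation is characterised up to biequivalence over [C];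
   [Cb] is therefore not required to be strict. *)
Definition injective_abelianisation (C Cb : bicat k I)
    (P : pseudofunctor C Cb) : Prop :=
  [/\ forall i j, abelian_cat (Cb i j) /\ enough_injectives (Cb i j),
      forall i j, fully_faithful (P i j),
      forall i j (X : Cb i j), injective_object X <-> ess_image (P i j) X
    & hc_left_exact Cb].

End Fiat.

Section DirectSum.
Variables (k : fieldType) (T : finType) (A : T -> lincat k).

Section Hom.
Variables x y : forall t, A t.

Definition dsum_hom : Type := {dffun forall t : T, hom (x t) (y t)}.

HB.instance Definition _ := Choice.on dsum_hom.

Implicit Types f g h : dsum_hom.

Definition dsum_zero : dsum_hom := [ffun t => 0].
Definition dsum_opp f : dsum_hom := [ffun t => - f t].
Definition dsum_add f g : dsum_hom := [ffun t => f t + g t].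
Definition dsum_scale (a : k) f : dsum_hom := [ffun t => a *: f t].

Fact dsum_addA : associative dsum_add.
Proof. by move=> f g h; apply/ffunP => t; rewrite !ffunE addrA. Qed.
Fact dsum_addC : commutative dsum_add.
Proof. by move=> f g; apply/ffunP => t; rewrite !ffunE addrC. Qed.
Fact dsum_add0 : left_id dsum_zero dsum_add.
Proof. by move=> f; apply/ffunP => t; rewrite !ffunE add0r. Qed.
Fact dsum_addN : left_inverse dsum_zero dsum_opp dsum_add.
Proof. by move=> f; apply/ffunP => t; rewrite !ffunE addNr. Qed.

HB.instance Definition _ :=
  GRing.isZmodule.Build dsum_hom dsum_addA dsum_addC dsum_add0 dsum_addN.

Fact dsum_scaleA a b f : dsum_scale a (dsum_scale b f) = dsum_scale (a * b) f.
Proof. by apply/ffunP => t; rewrite !ffunE scalerA. Qed.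
Fact dsum_scale1 : left_id 1 dsum_scale.
Proof. by move=> f; apply/ffunP => t; rewrite !ffunE scale1r. Qed.
Fact dsum_scaleDr : right_distributive dsum_scale +%R.
Proof. by move=> a f g; apply/ffunP => t; rewrite !ffunE scalerDr. Qed.
Fact dsum_scaleDl f : {morph dsum_scale^~ f : a b / a + b}.
Proof. by move=> a b; apply/ffunP => t; rewrite !ffunE scalerDl. Qed.

HB.instance Definition _ := GRing.Zmodule_isLmodule.Build k dsum_hom
  dsum_scaleA dsum_scale1 dsum_scaleDr dsum_scaleDl.

End Hom.

Definition dsum : lincat k.
Proof.
refine (@LinCat k (forall t, A t) (fun x y => dsum_hom x y)
  (fun x => [ffun t => idm (x t)])
  (fun x y z g f => [ffun t => g t \c f t]) _ _ _ _ _).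
- by move=> x y z t h g f; apply/ffunP => s; rewrite !ffunE compA.
- by move=> x y f; apply/ffunP => s; rewrite !ffunE comp1m.
- by move=> x y f; apply/ffunP => s; rewrite !ffunE compm1.
- by move=> x y z g a f f'; apply/ffunP => s; rewrite !ffunE comp_linr.
- by move=> x y z f a g g'; apply/ffunP => s; rewrite !ffunE comp_linl.
Defined.

End DirectSum.

Definition dsum_fun k (T : finType) (A B : T -> lincat k)
  (S : forall t, linfun (A t) (B t)) : linfun (dsum A) (dsum B).
Proof.
refine (@LinFun k (dsum A) (dsum B) (fun x t => S t (x t))
  (fun x y f => [ffun t => fmap (S t) (f t)]) _ _ _).
- by move=> x; apply/ffunP => t; rewrite !ffunE fmap1.
- by move=> x y z g f; apply/ffunP => t; rewrite !ffunE fmapM.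
- by move=> x y a f g; apply/ffunP => t; rewrite !ffunE fmap_lin.
Defined.

(* Non-composable composites being zero, a coalgebra structure on a direct sum
   of 1-morphisms [C i : i -> i] consists of one on each summand. *)
Record coalgebra k I (B : bicat k I) := Coalgebra {
  cob :> forall i, B i i;
  comul : forall i, hom (cob i) (cob i ** cob i);
  counit : forall i, hom (cob i) (id1 B i);
  comulA : forall i,
    fwd (asc (cob i) (cob i) (cob i)) \c (comul i *** idm (cob i)) \c comul i =
    (idm (cob i) *** comul i) \c comul i;
  counitl : forall i,
    fwd (lun (cob i)) \c (counit i *** idm (cob i)) \c comul i = idm (cob i);
  counitr : forall i,
    fwd (run (cob i)) \c (idm (cob i) *** counit i) \c comul i = idm (cob i)
}.

Section Comodules.
Variables (k : fieldType) (I : Type) (B : bicat k I) (C : coalgebra B).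
Variables i j : I.

Record comodule := Comodule {
  cmob :> B i j;
  coact : hom cmob (cmob ** C i);
  coactA :
    fwd (asc cmob (C i) (C i)) \c (coact *** idm (C i)) \c coact =
    (idm cmob *** comul C i) \c coact;
  coact1 : fwd (run cmob) \c (idm cmob *** counit C i) \c coact = idm cmob
}.

Section Hom.
Variables M N : comodule.

Definition comod_mor : {pred hom M N} := fun f =>
  coact N \c f == (f *** idm (C i)) \c coact M.

Fact comod_mor_closed : submod_closed comod_mor.
Proof.
split.
  by rewrite unfold_in compm0 (linear_at0 (hc2_linl _)) comp0m.
move=> a f g; rewrite !unfold_in => /eqP Ef /eqP Eg.
by rewrite comp_linr Ef Eg hc2_linl comp_linl.
Qed.

HB.instance Definition _ :=
  GRing.isSubmodClosed.Build k (hom M N) comod_mor comod_mor_closed.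

Record comod_hom := ComodHom {
  cmor :> hom M N;
  cmorP : cmor \in comod_mor
}.

HB.instance Definition _ := [isSub for cmor].
HB.instance Definition _ := [Choice of comod_hom by <:].
HB.instance Definition _ := [SubChoice_isSubLmodule of comod_hom by <:].

End Hom.

Arguments comod_mor : clear implicits.

Fact comod_id_subproof (M : comodule) : idm (M : B i j) \in comod_mor M M.
Proof. by rewrite unfold_in hc2_id compm1 comp1m. Qed.

Fact comod_comp_subproof (M N P : comodule) (g : comod_hom N P)
  (f : comod_hom M N) : (g : hom _ _) \c f \in comod_mor M P.
Proof.
have /eqP Ef := cmorP f; have /eqP Eg := cmorP g.
by rewrite unfold_in compA Eg -compA Ef compA rwhiskM.
Qed.

Definition comod_at : lincat k.
Proof.
refine (@LinCat k comodule (fun M N => comod_hom M N)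
  (fun M => ComodHom (comod_id_subproof M))
  (fun M N P g f => ComodHom (comod_comp_subproof g f)) _ _ _ _ _).
- by move=> x y z t h g f; apply: val_inj; apply: compA.
- by move=> x y f; apply: val_inj; apply: comp1m.
- by move=> x y f; apply: val_inj; apply: compm1.
- by move=> x y z g a f f'; apply: val_inj; apply: comp_linr.
- by move=> x y z f a g g'; apply: val_inj; apply: comp_linl.
Defined.

End Comodules.

Arguments coact {k I B C i j} c.
Arguments comod_mor {k I B C i j} M N.

(* An object is a formal direct sum of 1-morphisms [M (i, j) : i -> j], each
   coacted upon from the right by [C i]. *)
Definition comod k (I : finType) (B : bicat k I) (C : coalgebra B) : lincat k :=
  dsum (fun p : I * I => comod_at C p.1 p.2).

Record subcoalgebra k I (B : bicat k I) (C : coalgebra B) := SubCoalgebra {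
  subcoalg :> coalgebra B;
  incl : forall i, hom (subcoalg i) (C i);
  incl_mono : forall i, mono (incl i);
  incl_comul : forall i,
    comul C i \c incl i = (incl i *** incl i) \c comul subcoalg i;
  incl_counit : forall i, counit subcoalg i = counit C i \c incl i
}.

Arguments incl {k I B C} s i.

Section Cotensor.
Variables (k : fieldType) (I : Type) (B : bicat k I) (C : coalgebra B).
Variables (D : subcoalgebra C).

Section At.
Variables i j : I.

Section Obj.
Variable N : comodule D i j.

Definition cores_coact : hom N (N ** C i) := (idm N *** incl D i) \c coact N.

Fact cores_coactA :
  fwd (asc N (C i) (C i)) \c (cores_coact *** idm (C i)) \c cores_coact =
  (idm N *** comul C i) \c cores_coact.
Proof.
have EN := coactA N.
rewrite /cores_coact [RHS]compA -lwhiskM incl_comul lwhiskM -[RHS]compA -EN.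
rewrite -!compA (compA (_ *** idm (C i))) -hc2_comp comp1m compm1.
by rewrite [in RHS]compA -asc_nat -!compA (compA (_ *** incl D i)) -hc2_comp
  compm1.
Qed.

Fact cores_coact1 :
  fwd (run N) \c (idm N *** counit C i) \c cores_coact = idm (N : B i j).
Proof.
by rewrite -[RHS](coact1 N) /cores_coact -!compA (compA (idm N *** _)) -lwhiskM
  -incl_counit.
Qed.

Definition cores_ob : comodule C i j := Comodule cores_coactA cores_coact1.

End Obj.

Fact cores_mor_subproof (M N : comodule D i j) (f : comod_hom M N) :
  cmor f \in comod_mor (cores_ob M) (cores_ob N).
Proof.
have /eqP Ef := cmorP f.
rewrite unfold_in /= /cores_coact -compA Ef !compA -!hc2_comp.
by rewrite !comp1m !compm1.
Qed.

Definition cotensor_embedding_at : linfun (comod_at D i j) (comod_at C i j).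
Proof.
refine (@LinFun k (comod_at D i j) (comod_at C i j) cores_ob
  (fun M N f => ComodHom (cores_mor_subproof f)) _ _ _).
- by move=> M; apply: val_inj.
- by move=> M N P g f; apply: val_inj.
- by move=> M N a f g; apply: val_inj.
Defined.

End At.
End Cotensor.

(* The functor sending [N] to the cotensor product over [D] of [N] with [D],
   regarded as a [D]-[C]-bicomodule; up to isomorphism it keeps the 1-morphism
   [N] and composes its coaction with [incl D]. *)
Definition cotensor_embedding k (I : finType) (B : bicat k I) (C : coalgebra B)
  (D : subcoalgebra C) : linfun (comod D) (comod C) :=
  dsum_fun (fun p => cotensor_embedding_at D p.1 p.2).

Lemma left_exact_mono k (A B : lincat k) (T : linfun A B) (x y : A)
    (f : hom x y) :
  abelian_cat A -> left_exact T -> mono f -> mono (fmap T f).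
Proof.
move=> [_ _ _ mker _] lex /mker [w [g /lex [gf0 U]]] z u v E.
have h0 : fmap T g \c (fmap T f \c u) = 0.
  by rewrite compA gf0 comp0m.
have [s [_ sU]] := U _ _ h0.
by rewrite -(sU u erefl) -(sU v (esym E)).
Qed.

Lemma cotensor_embedding_fully_faithful k (I : finType) (B : bicat k I)
    (C : coalgebra B) (D : subcoalgebra C) :
  (forall i j, abelian_cat (B i j)) -> hc_left_exact B ->
  fully_faithful (cotensor_embedding D).
Proof.
move=> ab [lex _] M N.
have P (p : I * I) (f : comod_hom (cores_ob (M p)) (cores_ob (N p))) :
    cmor f \in comod_mor (M p) (N p).
  have /eqP Ef := cmorP f.
  rewrite unfold_in; apply/eqP.
  have mon := left_exact_mono (ab _ _) (lex _ _ _ (N p : B _ _)) (@incl_mono _ _ _ _ D p.1).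
  apply: mon => /=; move: Ef; rewrite /= /cores_coact -compA => ->.
  by rewrite !compA -!hc2_comp !comp1m !compm1.
pose inv (g : @hom k (comod C) (cotensor_embedding D M)
    (cotensor_embedding D N)) : @hom k (comod D) M N :=
  [ffun p => ComodHom (P p ((g : dsum_hom _ _) p))].
exists inv => f.
  apply/ffunP => p; rewrite ffunE; apply: val_inj => /=.
  by rewrite [in LHS]ffunE.
apply/ffunP => p; rewrite ffunE; apply: val_inj => /=.
by rewrite [in LHS]ffunE.
Qed.

(* [J] and [rho] are determined up to isomorphism: [J] is the cokernel of the
   inclusion, with the right [C]-coaction induced by the comultiplication.  As
   [**] is only left exact, asking that [D] be the preimage of the sum of
   subobjects [CD + DC] would be weaker than monicity of [J -> J ** J]: it holds
   for every [D] when [C] is the identity. *)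
Definition coidempotent k I (B : bicat k I) (C : coalgebra B)
    (D : subcoalgebra C) : Prop :=
  forall i, exists (J : B i i) (pi : hom (C i) J) (rho : hom J (J ** C i)),
    [/\ is_cokernel (incl D i) pi,
        rho \c pi = (pi *** idm (C i)) \c comul C i
      & mono ((idm J *** pi) \c rho)].

(* Main.v *)
Require Import Defs.
From mathcomp Require Import all_boot all_algebra.
Import Defs.

(** The argument is carried by one invariant. Let [pi : A -> J] be the cokernel
    of the inclusion [D -> A]. For a right [A]-comodule [M] with coaction
    [rho_M], call [residue pi M : M -> M J] the composite of [rho_M] with
    [id_M *** pi]. Whiskering by [M] is left exact, so [M D] is the kernel of
    [M A -> M J]; hence [rho_M] takes values in [M D], i.e. [M] comes from a
    [D]-comodule, exactly when its residue vanishes ([ess_image_residue]).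

    Residues are natural in [M], and kernels and cokernels of comodule morphisms
    are computed on the underlying 1-morphisms (right whiskering is left exact).
    So vanishing of the residue passes to subobjects and quotients for every [D];
    only extensions matter.

    Write [mu : J -> J J] for the map induced by the comultiplication.
    Coassociativity gives, up to the associator,
    [(id_M *** mu) \c residue = (residue *** id_J) \c residue]
    ([residue_square]). If [Y] is an extension of [Z] by [X], both with zero
    residue, then the residue of [Y] factors through [X J] and the right-hand
    side is zero; when [mu] is mono this forces the residue of [Y] to be zero
    ([coidempotent_serre_at]).

    Conversely, let [E] be the kernel of [mu \c pi], a right subcomodule of [A]
    containing [D]. The quotient [T] of [E] by [D] embeds in [J] with image
    inside the kernel of [mu], which makes its residue zero. So [E] is an
    extension of [T] by [D], and if the image of the embedding is closed under
    extensions then the residue of [E] vanishes. By counitality [E] is then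
    killed by [pi], so [D] is the whole kernel of [mu \c pi], and [mu], being
    the induced map on the coimage, is mono ([serre_at_coidempotent]).

    All this concerns comodules from one fixed object to another; a comodule in
    general is a finite family of these, and being a Serre subcategory is
    checked componentwise ([serre_dsum]). *)

Set Implicit Arguments.
Unset Strict Implicit.
Unset Printing Implicit Defensive.

Import GRing.Theory.
Local Open Scope ring_scope.
Local Open Scope cat_scope.

(** * Kernels, cokernels and Serre subcategories *)

Section LinearCategories.
Variables (k : fieldType) (A : lincat k).
Implicit Types x y z w : A.

Lemma mono_ker0 x y (f : hom x y) :
  (forall z (u : hom z x), f \c u = 0 -> u = 0) -> mono f.
Proof.
move=> f0 z u v E; apply/subr0_eq/f0.
by have := comp_linr f (-1) v u; rewrite /= !scaleN1r E addNr addrC.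
Qed.

Lemma mono_eq0 x y (f : hom x y) z (u : hom z x) :
  mono f -> f \c u = 0 -> u = 0.
Proof. by move=> fm E; apply: fm; rewrite E compm0. Qed.

Lemma epi_eq0 x y (f : hom x y) z (u : hom y z) :
  epi f -> u \c f = 0 -> u = 0.
Proof. by move=> fe E; apply: fe; rewrite E comp0m. Qed.

Lemma kernel_factor x y (f : hom x y) w (m : hom w x) z (h : hom z x) :
  is_kernel f m -> f \c h = 0 -> exists u, m \c u = h.
Proof. by move=> [_ U] /U[u [E _]]; exists u. Qed.

Lemma cokernel_factor x y (f : hom x y) w (p : hom y w) z (h : hom y z) :
  is_cokernel f p -> h \c f = 0 -> exists u, u \c p = h.
Proof. by move=> [_ U] /U[u [E _]]; exists u. Qed.

Lemma kernel_mono x y (f : hom x y) w (m : hom w x) : is_kernel f m -> mono m.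
Proof.
move=> [fm U] z u v E.
have [t [_ tU]] := U z (m \c u) ltac:(by rewrite compA fm comp0m).
by rewrite -(tU u) // -(tU v).
Qed.

Lemma cokernel_epi x y (f : hom x y) w (p : hom y w) : is_cokernel f p -> epi p.
Proof.
move=> [pf U] z u v E.
have [t [_ tU]] := U z (u \c p) ltac:(by rewrite -compA pf compm0).
by rewrite -(tU u) // -(tU v).
Qed.

Lemma is_kernelP x y (f : hom x y) w (m : hom w x) :
  mono m -> f \c m = 0 ->
  (forall z (h : hom z x), f \c h = 0 -> exists u, m \c u = h) -> is_kernel f m.
Proof.
move=> mm fm U; split=> // z h /U[u E]; exists u; split=> // v Ev.
by apply: mm; rewrite E.
Qed.

Lemma is_cokernelP x y (f : hom x y) w (p : hom y w) :
  epi p -> p \c f = 0 ->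
  (forall z (h : hom y z), h \c f = 0 -> exists u, u \c p = h) ->
  is_cokernel f p.
Proof.
move=> pe pf U; split=> // z h /U[u E]; exists u; split=> // v Ev.
by apply: pe; rewrite E.
Qed.

Lemma is_zero_hom x y (f : hom x y) : is_zero x -> f = 0.
Proof. by move=> x0; rewrite -[f]compm1 x0 compm0. Qed.

Lemma mono_kernel_of_cokernel x y (m : hom x y) w (p : hom y w) :
  abelian_cat A -> mono m -> is_cokernel m p -> is_kernel p m.
Proof.
move=> [_ _ _ mker _] mm mp; apply: is_kernelP => // [|z h ph]; first exact: mp.1.
have [v [g gm]] := mker _ _ _ mm.
have [s E] := cokernel_factor mp gm.1.
by apply: kernel_factor gm _; rewrite -E -compA ph compm0.
Qed.

(** The map induced by [f] on its coimage is mono. Let [q] be the cokernel of a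
    map [u] killed by [s]; then [s], hence [f], factors through [q]. The epi
    [q \c p] is the cokernel of some [g], and [f] kills [g], so [g] comes from
    the kernel of [f] and [p] kills it too. Thus [p] factors through [q \c p],
    which makes [q] split mono and [u] zero. *)
Lemma coimage_mono x y z w (f : hom x y) (m : hom w x) (p : hom x z)
    (s : hom z y) :
  abelian_cat A -> is_kernel f m -> is_cokernel m p -> f = s \c p -> mono s.
Proof.
move=> [_ _ coker _ ecoker] fm mp E; apply: mono_ker0 => v u su.
have [c [q uq]] := coker _ _ u.
have [s' Es] := cokernel_factor uq su.
have qpe : epi (q \c p).
  move=> t a b; rewrite !compA => /(cokernel_epi mp).
  exact: (cokernel_epi uq).
have [a [g gqp]] := ecoker _ _ _ qpe.
have fg : f \c g = 0 by rewrite E -Es -!compA [q \c _]compA gqp.1 compm0.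
have [g' Eg] := kernel_factor fm fg.
have pg : p \c g = 0 by rewrite -Eg compA mp.1 comp0m.
have [r Er] := cokernel_factor gqp pg.
have rq : r \c q = idm z.
  by apply: (cokernel_epi mp); rewrite -compA Er comp1m.
by rewrite -[u]comp1m -rq -compA uq.1 compm0.
Qed.

Lemma eq_serre (S S' : A -> Prop) :
  (forall x, S x <-> S' x) -> serre S <-> serre S'.
Proof.
suff H (R R' : A -> Prop) : (forall x, R x <-> R' x) -> serre R -> serre R'.
  by move=> E; split; apply: H => // x; apply: iff_sym.
move=> E [sub quo ext]; split=> [x y m mm /E Ry | x y p pe /E Rx |
  x y z f g fg /E Rx /E Rz]; apply/E.
- exact: sub mm Ry.
- exact: quo pe Rx.
exact: ext fg Rx Rz.
Qed.

End LinearCategories.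

(** * Finite families of categories *)

Section DirectSums.
Variables (k : fieldType) (T : finType) (A : T -> lincat k).

Definition proj_hom (x y : dsum A) (f : hom x y) t : hom (x t) (y t) :=
  (f : dsum_hom x y) t.

Definition tuple_hom (x y : dsum A) (f : forall t, hom (x t) (y t)) :
  hom x y := [ffun t => f t] : dsum_hom x y.

Lemma dsum_homP (x y : dsum A) (f g : hom x y) :
  (forall t, proj_hom f t = proj_hom g t) -> f = g.
Proof. by move=> E; apply/ffunP. Qed.

Lemma tuple_homE (x y : dsum A) (f : forall t, hom (x t) (y t)) t :
  proj_hom (tuple_hom f : hom x y) t = f t.
Proof. by rewrite /proj_hom ffunE. Qed.

Lemma proj_hom_comp (x y z : dsum A) (g : hom y z) (f : hom x y) t :
  proj_hom (g \c f) t = proj_hom g t \c proj_hom f t.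
Proof. by rewrite /proj_hom ffunE. Qed.

Lemma proj_hom_id (x : dsum A) t : proj_hom (idm x) t = idm (x t).
Proof. by rewrite /proj_hom ffunE. Qed.

Lemma proj_hom0 (x y : dsum A) t : proj_hom (0 : hom x y) t = 0.
Proof. by rewrite /proj_hom ffunE. Qed.

Definition dsumE := (proj_hom_comp, tuple_homE, proj_hom_id, proj_hom0).

(** A test pair for one component has to be completed to a test pair for the
    whole family. The completion is chosen componentwise, together with an
    implication that leads back to the given pair when [t = p]; this avoids
    transporting morphisms along that equality. *)
Lemma mono_proj p (x y : dsum A) (m : hom x y) :
  mono m -> mono (proj_hom m p).
Proof.
move=> mm z0 g0 h0 E0.
have : forall t, exists z (g h : hom z (x t)),
    proj_hom m t \c g = proj_hom m t \c h /\ (t = p -> g = h -> g0 = h0).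
  move=> t; case: (eqVneq t p) => [->|/eqP tp]; first by exists z0, g0, h0.
  by exists (x t), 0, 0.
move=> /fin_all_exists[z] /fin_all_exists[g] /fin_all_exists[h] H.
apply: (H p).2 => //.
have E : m \c (tuple_hom g : hom (z : dsum A) x) = m \c tuple_hom h.
  by apply: dsum_homP => t; rewrite !dsumE (H t).1.
by have /(congr1 (fun f => proj_hom f p)) := mm _ _ _ E; rewrite !dsumE.
Qed.

Lemma kernel_proj p (x y w : dsum A) (f : hom x y) (m : hom w x) :
  is_kernel f m -> is_kernel (proj_hom f p) (proj_hom m p).
Proof.
move=> fm; apply: is_kernelP => [||z0 h0 E0].
- exact/mono_proj/(kernel_mono fm).
- by rewrite -proj_hom_comp fm.1 dsumE.
have : forall t, exists z (h : hom z (x t)), proj_hom f t \c h = 0 /\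
    (t = p -> (exists u, proj_hom m t \c u = h) ->
     exists u, proj_hom m p \c u = h0).
  move=> t; case: (eqVneq t p) => [->|/eqP tp]; first by exists z0, h0.
  by exists (x t), 0; rewrite compm0.
move=> /fin_all_exists[z] /fin_all_exists[h] H.
apply: (H p).2 => //.
have E : f \c (tuple_hom h : hom (z : dsum A) x) = 0.
  by apply: dsum_homP => t; rewrite !dsumE (H t).1.
have [u Eu] := kernel_factor fm E.
by exists (proj_hom u p); rewrite -proj_hom_comp Eu dsumE.
Qed.

Lemma mono_tuple (x y : dsum A) (m : forall t, hom (x t) (y t)) :
  (forall t, mono (m t)) -> mono (tuple_hom m : hom x y).
Proof.
move=> mm z g h E; apply: dsum_homP => t; apply: mm.
by have /(congr1 (fun f => proj_hom f t)) := E; rewrite !dsumE.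
Qed.

Lemma kernel_tuple (x y w : dsum A) (f : forall t, hom (x t) (y t))
    (m : forall t, hom (w t) (x t)) :
  (forall t, is_kernel (f t) (m t)) ->
  is_kernel (tuple_hom f : hom x y) (tuple_hom m : hom w x).
Proof.
move=> fm; apply: is_kernelP => [||z h E].
- by apply: mono_tuple => t; apply: kernel_mono (fm t).
- by apply: dsum_homP => t; rewrite !dsumE (fm t).1.
have : forall t, exists u, m t \c u = proj_hom h t.
  move=> t; apply: kernel_factor (fm t) _.
  by have /(congr1 (fun f => proj_hom f t)) := E; rewrite !dsumE.
move=> /fin_all_exists[u Eu]; exists (tuple_hom u).
by apply: dsum_homP => t; rewrite !dsumE.
Qed.

End DirectSums.

Section DirectSumsDual.
Variables (k : fieldType) (T : finType) (A : T -> lincat k).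

Let Aop t := opcat (A t).

(* Duals, read off from the family of opposite categories. *)

Lemma epi_proj t (x y : dsum A) (p : hom x y) :
  epi p -> epi (proj_hom p t).
Proof. exact: (@mono_proj k T Aop t y x p). Qed.

Lemma epi_tuple (x y : dsum A) (p : forall t, hom (x t) (y t)) :
  (forall t, epi (p t)) -> epi (tuple_hom p : hom x y).
Proof. exact: (@mono_tuple k T Aop y x p). Qed.

Lemma cokernel_proj t (x y w : dsum A) (f : hom x y) (p : hom y w) :
  is_cokernel f p -> is_cokernel (proj_hom f t) (proj_hom p t).
Proof. exact: (@kernel_proj k T Aop t y x w f p). Qed.

Lemma cokernel_tuple (x y w : dsum A) (f : forall t, hom (x t) (y t))
    (p : forall t, hom (y t) (w t)) :
  (forall t, is_cokernel (f t) (p t)) ->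
  is_cokernel (tuple_hom f : hom x y) (tuple_hom p : hom y w).
Proof. exact: (@kernel_tuple k T Aop y x w f p). Qed.

(** Passing from the family to a component uses the zero objects: they complete
    a mono, an epi or a short exact sequence of one component to one of the
    family without affecting the other components. *)
Lemma serre_dsum (S : forall t, A t -> Prop) :
  (forall t, exists o : A t, is_zero o /\ S t o) ->
  serre (fun x : dsum A => forall t, S t (x t)) <-> forall t, serre (S t).
Proof.
move=> Ho; split=> [[sub quo ext] p | H]; last first.
  split=> [x y m mm Sy t | x y q qe Sx t | x y z f g fg Sx Sz t].
  - by have [sub _ _] := H t; apply: sub (Sy t); apply: mono_proj mm.
  - by have [_ quo _] := H t; apply: quo (Sx t); apply: epi_proj qe.
  have [_ _ ext] := H t; apply: ext (Sx t) (Sz t).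
  by split; [exact: kernel_proj fg.1 | exact: cokernel_proj fg.2].
split=> [x0 y0 m0 mm0 Sy0 | x0 y0 q0 qe0 Sx0 | x0 y0 z0 f0 g0 fg0 Sx0 Sz0].
- have : forall t, exists x y (m : hom x y),
      [/\ mono m, S t y & t = p -> S t x -> S p x0].
    move=> t; case: (eqVneq t p) => [->|/eqP tp]; first by exists x0, y0, m0.
    have [o [_ So]] := Ho t; exists o, o, (idm o); split=> // z g h.
    by rewrite !comp1m.
  move=> /fin_all_exists[x] /fin_all_exists[y] /fin_all_exists[m] {}H.
  have [_ _] := H p; apply=> //.
  apply: (sub x y (tuple_hom m)); first by apply: mono_tuple => t; case: (H t).
  by move=> t; case: (H t).
- have : forall t, exists x y (q : hom x y),
      [/\ epi q, S t x & t = p -> S t y -> S p y0].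
    move=> t; case: (eqVneq t p) => [->|/eqP tp]; first by exists x0, y0, q0.
    have [o [_ So]] := Ho t; exists o, o, (idm o); split=> // z g h.
    by rewrite !compm1.
  move=> /fin_all_exists[x] /fin_all_exists[y] /fin_all_exists[q] {}H.
  have [_ _] := H p; apply=> //.
  apply: (quo x y (tuple_hom q)); first by apply: epi_tuple => t; case: (H t).
  by move=> t; case: (H t).
have : forall t, exists x y z (f : hom x y) (g : hom y z),
    [/\ short_exact f g, S t x, S t z & t = p -> S t y -> S p y0].
  move=> t; case: (eqVneq t p) => [->|/eqP tp].
    by exists x0, y0, z0, f0, g0.
  have [o [o0 So]] := Ho t; exists o, o, o, (idm o), (idm o); split=> //.
  have oo : idm o \c idm o = 0 by rewrite comp1m o0.
  split.
    apply: is_kernelP => // [z g h|z h]; rewrite ?comp1m // => ->.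
    by exists 0; rewrite compm0.
  apply: is_cokernelP => // [z g h|z h]; rewrite ?compm1 // => ->.
  by exists 0; rewrite comp0m.
move=> /fin_all_exists[x] /fin_all_exists[y] /fin_all_exists[z].
move=> /fin_all_exists[f] /fin_all_exists[g] {}H.
have [_ _ _] := H p; apply=> //.
apply: (ext x y z (tuple_hom f) (tuple_hom g)).
- split; [apply: kernel_tuple | apply: cokernel_tuple] => t;
    by case: (H t) => [[]].
- by move=> t; case: (H t).
by move=> t; case: (H t).
Qed.

Lemma ess_image_dsum_fun (A' : T -> lincat k)
    (F : forall t, linfun (A' t) (A t)) (y : dsum A) :
  ess_image (dsum_fun F) y <-> forall t, ess_image (F t) (y t).
Proof.
split=> [[x [[f g gf fg]]] t | H].
  exists (x t); split; exists (proj_hom f t) (proj_hom g t).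
    by rewrite -proj_hom_comp gf proj_hom_id.
  by rewrite -proj_hom_comp fg proj_hom_id.
have : forall t, exists x (f : hom (F t x) (y t)) (g : hom (y t) (F t x)),
    g \c f = idm _ /\ f \c g = idm _.
  by move=> t; have [x [[f g gf fg]]] := H t; exists x, f, g.
move=> /fin_all_exists[x] /fin_all_exists[f] /fin_all_exists[g] {}H.
exists x; split.
exists (tuple_hom f : hom (dsum_fun F x) y) (tuple_hom g).
  by apply: dsum_homP => t; rewrite !dsumE (H t).1.
by apply: dsum_homP => t; rewrite !dsumE (H t).2.
Qed.

End DirectSumsDual.

(** * Kernels and cokernels of comodule morphisms *)

Section Comodules.
Variables (k : fieldType) (I : Type) (B : bicat k I).
Hypotheses (ab : forall i j, abelian_cat (B i j)) (lex : hc_left_exact B).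

Lemma kernel_lwhisk i j l (M : B j l) (x y w : B i j) (f : hom x y)
    (m : hom w x) :
  is_kernel f m -> is_kernel (idm M *** f) (idm M *** m).
Proof. exact: lex.1. Qed.

Lemma kernel_rwhisk i j l (N : B i j) (x y w : B j l) (f : hom x y)
    (m : hom w x) :
  is_kernel f m -> is_kernel (f *** idm N) (m *** idm N).
Proof. exact: lex.2. Qed.

Lemma mono_lwhisk i j l (M : B j l) (x y : B i j) (m : hom x y) :
  mono m -> mono (idm M *** m).
Proof. exact: left_exact_mono (ab i j) (@lex.1 i j l M). Qed.

Lemma mono_rwhisk i j l (N : B i j) (x y : B j l) (m : hom x y) :
  mono m -> mono (m *** idm N).
Proof. exact: left_exact_mono (ab j l) (@lex.2 i j l N). Qed.

Lemma lwhisk0 i j l (M : B j l) (x y : B i j) :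
  idm M *** (0 : hom x y) = 0.
Proof. exact: linear_at0 (hc2_linr _). Qed.

Lemma rwhisk0 i j l (N : B i j) (x y : B j l) :
  (0 : hom x y) *** idm N = 0.
Proof. exact: linear_at0 (hc2_linl _). Qed.

Lemma hc2_lr i j l (F F' : B j l) (G G' : B i j) (f : hom F F') (g : hom G G') :
  (f *** idm G') \c (idm F *** g) = f *** g.
Proof. by rewrite -hc2_comp comp1m compm1. Qed.

Lemma hc2_rl i j l (F F' : B j l) (G G' : B i j) (f : hom F F') (g : hom G G') :
  (idm F' *** g) \c (f *** idm G) = f *** g.
Proof. by rewrite -hc2_comp comp1m compm1. Qed.

Variable C : coalgebra B.

Section At.
Variables i j : I.
Implicit Types M N : comodule C i j.

Lemma comod_homE M N (f : @hom k (comod_at C i j) M N) :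
  coact N \c cmor f = (cmor f *** idm (C i)) \c coact M.
Proof. exact/eqP/(cmorP f). Qed.

Lemma comod_hom_ex M N (f : hom (cmob M) (cmob N)) :
  coact N \c f = (f *** idm (C i)) \c coact M ->
  exists g : @hom k (comod_at C i j) M N, cmor g = f.
Proof.
move=> E; have Pf : f \in comod_mor M N by rewrite unfold_in E.
by exists (ComodHom Pf).
Qed.

Lemma comod_hom_inj M N (f g : @hom k (comod_at C i j) M N) :
  cmor f = cmor g -> f = g.
Proof. exact: val_inj. Qed.

(** If the coaction of [M] restricts along a mono [m : x -> M], then [x] is a
    comodule: its axioms hold after composing with the monos [m] and
    [m *** id]. *)
Section Sub.
Variables (M : comodule C i j) (x : B i j) (m : hom x (cmob M)).
Variables (r : hom x (x ** C i)).
Hypotheses (mm : mono m) (mr : coact M \c m = (m *** idm (C i)) \c r).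

Fact subcomodA :
  fwd (asc x (C i) (C i)) \c (r *** idm (C i)) \c r = (idm x *** comul C i) \c r.
Proof.
apply: (mono_rwhisk mm); rewrite [RHS]compA hc2_lr -(hc2_rl m (comul C i)) -[RHS]compA -mr.
rewrite [RHS]compA -coactA -lwhisk1 2!compA -asc_nat -!compA; congr (_ \c _).
by rewrite mr [LHS]compA [RHS]compA -!rwhiskM mr.
Qed.

Fact subcomod1 : fwd (run x) \c (idm x *** counit C i) \c r = idm x.
Proof.
apply: mm; rewrite compm1 !compA -run_nat -[X in X \c r]compA.
rewrite hc2_lr -hc2_rl -!compA -mr.
by rewrite 2!compA coact1 comp1m.
Qed.

Definition subcomod := Comodule subcomodA subcomod1.

Lemma subcomod_incl : exists n : @hom k (comod_at C i j) subcomod M, cmor n = m.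
Proof. exact: comod_hom_ex. Qed.

End Sub.

(** A map induced by the coaction of [M] on the target of an epi is a coaction,
    as its axioms hold after precomposing with the epi. *)
Section Quotient.
Variables (M : comodule C i j) (x : B i j) (p : hom (cmob M) x).
Variables (r : hom x (x ** C i)).
Hypotheses (pe : epi p) (pr : r \c p = (p *** idm (C i)) \c coact M).

Fact quocomodA :
  fwd (asc x (C i) (C i)) \c (r *** idm (C i)) \c r = (idm x *** comul C i) \c r.
Proof.
apply: pe; rewrite -!compA pr [(r *** _) \c _]compA -rwhiskM pr rwhiskM.
rewrite [RHS]compA hc2_rl -(hc2_lr p (comul C i)) -[RHS]compA -coactA !compA.
by rewrite asc_nat hc2_id.
Qed.

Fact quocomod1 : fwd (run x) \c (idm x *** counit C i) \c r = idm x.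
Proof.
apply: pe; rewrite comp1m -!compA pr [(_ *** counit C i) \c _]compA.
rewrite hc2_rl -(hc2_lr p (counit C i)) !compA run_nat.
by rewrite -!(compA p) coact1 compm1.
Qed.

Definition quocomod := Comodule quocomodA quocomod1.

Lemma quocomod_proj : exists q : @hom k (comod_at C i j) M quocomod, cmor q = p.
Proof. exact: (@comod_hom_ex M quocomod p pr). Qed.

End Quotient.


(** The kernel of the underlying 2-morphism is a subcomodule, because whiskering
    it by [C i] gives a kernel again; it is then zero by monicity among
    comodules. *)
Lemma comod_mono M N (f : @hom k (comod_at C i j) M N) :
  mono f -> mono (cmor f).
Proof.
move=> fm; have [_ ker _ _ _] := ab i j; have [x [m fk]] := ker _ _ (cmor f).
have [|r Er] := kernel_factor (h := coact M \c m) (kernel_rwhisk (C i) fk).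
  by rewrite compA -comod_homE -compA fk.1 compm0.
have [n En] := subcomod_incl (kernel_mono fk) (esym Er).
have n0 : n = 0.
  by apply: (mono_eq0 fm); apply: comod_hom_inj; rewrite /= En fk.1.
apply: mono_ker0 => z u fu; have [v <-] := kernel_factor fk fu.
by rewrite -En n0 comp0m.
Qed.

(** The cokernel of the underlying 2-morphism is a quotient comodule, and is zero
    since [f] is epi among comodules. *)
Lemma comod_epi M N (f : @hom k (comod_at C i j) M N) :
  epi f -> epi (cmor f).
Proof.
move=> fe; have [_ _ coker _ _] := ab i j.
have [x [p fp]] := coker _ _ (cmor f).
have [|r Er] := cokernel_factor (h := (p *** idm (C i)) \c coact N) fp.
  by rewrite -compA comod_homE compA -rwhiskM fp.1 rwhisk0 comp0m.
have [q Eq] := quocomod_proj (cokernel_epi fp) Er.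
have q0 : q = 0.
  by apply: (epi_eq0 fe); apply: comod_hom_inj; rewrite /= Eq fp.1.
apply: (@mono_ker0 _ (opcat (B i j)) _ _ (cmor f)) => z u fu.
have [v <-] := cokernel_factor fp fu.
by rewrite -Eq q0 /= compm0.
Qed.

Lemma comod_kernel M N K (f : @hom k (comod_at C i j) M N)
    (m : @hom k (comod_at C i j) K M) :
  is_kernel f m -> is_kernel (cmor f) (cmor m).
Proof.
move=> fm; have [_ ker _ _ _] := ab i j; have [x [n fk]] := ker _ _ (cmor f).
have [|r Er] := kernel_factor (h := coact M \c n) (kernel_rwhisk (C i) fk).
  by rewrite compA -comod_homE -compA fk.1 compm0.
have [n' En] := subcomod_incl (kernel_mono fk) (esym Er).
have fn : f \c n' = 0 by apply: comod_hom_inj; rewrite /= En fk.1.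
have [s Es] := kernel_factor fm fn.
apply: is_kernelP => [||z h fh].
- exact/comod_mono/(kernel_mono fm).
- by rewrite -[LHS]/(cmor (f \c m)) fm.1.
have [v <-] := kernel_factor fk fh.
by exists (cmor s \c v); rewrite compA -[cmor m \c _]/(cmor (m \c s)) Es En.
Qed.

Lemma kernel_comod M N K (f : @hom k (comod_at C i j) M N)
    (m : @hom k (comod_at C i j) K M) :
  is_kernel (cmor f) (cmor m) -> is_kernel f m.
Proof.
move=> fm; have mm := kernel_mono fm.
apply: is_kernelP => [z g h E||z h fh].
- by apply/comod_hom_inj/mm; rewrite -[LHS]/(cmor (m \c g)) E.
- by apply: comod_hom_inj; apply: fm.1.
have [|u Eu] := kernel_factor (h := cmor h) fm.
  by rewrite -[LHS]/(cmor (f \c h)) fh.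
have [|v Ev] := @comod_hom_ex z K u.
  apply: (mono_rwhisk mm); rewrite compA -comod_homE -compA Eu comod_homE -Eu.
  by rewrite rwhiskM compA.
by exists v; apply: comod_hom_inj; rewrite /= Ev.
Qed.

Lemma cokernel_comod M N Q (f : @hom k (comod_at C i j) M N)
    (p : @hom k (comod_at C i j) N Q) :
  is_cokernel (cmor f) (cmor p) -> is_cokernel f p.
Proof.
move=> fp; have pe := cokernel_epi fp.
apply: is_cokernelP => [z g h E||z h fh].
- by apply/comod_hom_inj/pe; rewrite -[LHS]/(cmor (g \c p)) E.
- by apply: comod_hom_inj; apply: fp.1.
have [|u Eu] := cokernel_factor (h := cmor h) fp.
  by rewrite -[LHS]/(cmor (h \c f)) fh.
have [|v Ev] := @comod_hom_ex Q z u.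
  apply: pe; rewrite -!compA Eu comod_homE [in RHS](comod_homE p).
  by rewrite compA -rwhiskM Eu.
by exists v; apply: comod_hom_inj; rewrite /= Ev.
Qed.

End At.
End Comodules.

(** * Comodules over a subcoalgebra *)

Section SubCoalgebra.
Variables (k : fieldType) (I : Type) (B : bicat k I).
Hypotheses (ab : forall i j, abelian_cat (B i j)) (lex : hc_left_exact B).
Variables (C : coalgebra B) (D : subcoalgebra C).

(** The obstruction for the coaction of [M] to take values in [M ** D i], when
    [pi] is the cokernel of the inclusion of [D i]. *)
Definition residue i j (J : B i i) (pi : hom (C i) J) (M : comodule C i j) :
  hom (cmob M) (cmob M ** J) := (idm (cmob M) *** pi) \c coact M.

Lemma residue_nat i j (J : B i i) (pi : hom (C i) J) (M N : comodule C i j)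
    (f : @hom k (comod_at C i j) M N) :
  residue pi N \c cmor f = (cmor f *** idm J) \c residue pi M.
Proof. by rewrite /residue -compA comod_homE !compA hc2_lr hc2_rl. Qed.

Lemma residue_cores i j (J : B i i) (pi : hom (C i) J) (N : comodule D i j) :
  pi \c incl D i = 0 -> residue pi (cores_ob N) = 0.
Proof.
by move=> E; rewrite /residue /= /cores_coact compA -lwhiskM E lwhisk0 comp0m.
Qed.

(** A factorisation [u] of the coaction of [M] through [M ** D i] is a
    [D]-coaction, as can be tested after the inclusion into [M ** C i]. *)
Section Corestriction.
Variables (i j : I) (M : comodule C i j) (u : hom (cmob M) (cmob M ** D i)).
Hypothesis Eu : (idm (cmob M) *** incl D i) \c u = coact M.

Fact corestrictA :
  fwd (asc (cmob M) (D i) (D i)) \c (u *** idm (D i)) \c u =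
  (idm (cmob M) *** comul D i) \c u.
Proof.
have dm : mono (idm (cmob M) *** (incl D i *** incl D i)).
  apply: mono_lwhisk => //; rewrite -hc2_lr => z g h; rewrite -!compA.
  move=> /(mono_rwhisk ab lex (incl_mono (i := i))).
  exact: (mono_lwhisk ab lex (incl_mono (i := i))).
apply: dm; rewrite [RHS]compA -lwhiskM -incl_comul lwhiskM -[RHS]compA Eu.
rewrite -coactA !compA -asc_nat -!compA; congr (_ \c _).
by rewrite [LHS]compA -hc2_comp Eu compm1 -hc2_lr -compA Eu.
Qed.

Fact corestrict1 :
  fwd (run (cmob M)) \c (idm (cmob M) *** counit D i) \c u = idm (cmob M).
Proof. by rewrite incl_counit lwhiskM -!compA Eu compA coact1. Qed.

Definition corestrict := Comodule corestrictA corestrict1.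

Lemma corestrict_image : ess_image (cotensor_embedding_at D i j) M.
Proof.
have E : coact M \c idm (cmob M) =
    (idm (cmob M) *** idm (C i)) \c coact (cores_ob corestrict).
  by rewrite hc2_id comp1m compm1 /= /cores_coact.
have E' : coact (cores_ob corestrict) \c idm (cmob M) =
    (idm (cmob M) *** idm (C i)) \c coact M.
  by rewrite hc2_id comp1m compm1 /= /cores_coact.
have [f Ef] := @comod_hom_ex _ _ _ C _ _ (cores_ob corestrict) M _ E.
have [g Eg] := @comod_hom_ex _ _ _ C _ _ M (cores_ob corestrict) _ E'.
exists corestrict; split; exists f g; apply: comod_hom_inj;
  by rewrite /= Ef Eg comp1m.
Qed.

End Corestriction.

Lemma ess_image_residue i j (J : B i i) (pi : hom (C i) J)
    (M : comod_at C i j) :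
  is_cokernel (incl D i) pi ->
  ess_image (cotensor_embedding_at D i j) M <-> residue pi M = 0.
Proof.
move=> Dpi; split=> [[N [[f g _ fg]]]|].
  have := residue_nat pi f; rewrite residue_cores ?compm0; last exact: Dpi.1.
  move=> E; rewrite -[residue pi M]compm1.
  by rewrite -[idm _]/(cmor (idm M)) -fg /= compA E comp0m.
have piD := mono_kernel_of_cokernel (ab i i) (incl_mono (i := i)) Dpi.
move=> /(kernel_factor (kernel_lwhisk lex (cmob M) piD))[u Eu].
exact: corestrict_image Eu.
Qed.

Lemma ess_image_zero i j :
  exists o : comod_at C i j,
    is_zero o /\ ess_image (cotensor_embedding_at D i j) o.
Proof.
have [[[z z0] _] _ _ _ _] := ab i j.
have E x (f g : hom z x) : f = g by rewrite (is_zero_hom f) // (is_zero_hom g).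
pose N : comodule D i j := @Comodule _ _ _ D i j z 0 (E _ _ _) (E _ _ _).
exists (cores_ob N); split; first exact/comod_hom_inj/z0.
by exists N; split; exists (idm _) (idm _); rewrite comp1m.
Qed.

Section Quotient.
Variables (i : I) (J : B i i) (pi : hom (C i) J) (rho : hom J (J ** C i)).
Hypotheses (Dpi : is_cokernel (incl D i) pi).
Hypothesis (Erho : rho \c pi = (pi *** idm (C i)) \c comul C i).

Let mu : hom J (J ** J) := (idm J *** pi) \c rho.

(** Coassociativity of [M] with both copies of [C i] projected to [J]. *)
Lemma residue_square j (M : comodule C i j) :
  (idm (cmob M) *** mu) \c residue pi M =
  fwd (asc (cmob M) J J) \c (residue pi M *** idm J) \c residue pi M.
Proof.
rewrite /mu /residue [LHS]compA -lwhiskM -compA Erho compA hc2_rl.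
rewrite lwhiskM -compA -coactA !compA -asc_nat -!compA; congr (_ \c _).
by rewrite [LHS]compA [RHS]compA hc2_lr -hc2_comp compm1.
Qed.

(** In an extension [x -> y -> z] the residue of [y] is zero after [y -> z], so
    it factors through [x ** J], on which [residue pi y *** idm J] is zero
    because the residue of [x] vanishes. Then [residue_square] applies. *)
Lemma coidempotent_serre_at j :
  mono mu -> serre (ess_image (cotensor_embedding_at D i j)).
Proof.
move=> mum; apply: (eq_serre (fun M => ess_image_residue M Dpi)).2.
split=> [x y m mm Ey | x y p pe Ex | x y z f g [gf _] Ex Ez].
- have mJ := mono_rwhisk ab lex (N := J) (comod_mono ab lex mm).
  by apply: (mono_eq0 mJ); rewrite -residue_nat Ey comp0m.
- by apply: (epi_eq0 (comod_epi ab pe)); rewrite residue_nat Ex compm0.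
have fgJ := kernel_rwhisk lex J (comod_kernel ab lex gf).
have [|h Eh] := kernel_factor (h := residue pi y) fgJ.
  by rewrite -residue_nat Ez comp0m.
apply: (mono_eq0 (mono_lwhisk ab lex (M := cmob y) mum)).
rewrite residue_square -{2}Eh -compA [X in _ \c X]compA -rwhiskM.
by rewrite residue_nat Ex compm0 rwhisk0 comp0m compm0.
Qed.

Definition regular_comodule (A : coalgebra B) l : comodule A l l :=
  Comodule (comulA A l) (counitr A l).

(** [mu] is a map of right comodules, [J ** J] being coacted upon through its
    right factor; hence the kernels built from it are subcomodules. *)
Lemma mu_comul :
  fwd (asc J J (C i)) \c (mu *** idm (C i)) \c rho = (idm J *** rho) \c mu.
Proof.
have rhoA := quocomodA (M := regular_comodule C i) (cokernel_epi Dpi) Erho.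
rewrite /mu rwhiskM !compA asc_nat -[X in X \c rho]compA -[LHS]compA rhoA.
by rewrite !compA -!lwhiskM Erho.
Qed.

(** The extension used is [D -> E -> T], with [E] the kernel of [mu \c pi] on
    the regular comodule: the largest candidate for an extension, inside [C], of
    comodules with zero residue by [D]. *)
Lemma serre_at_coidempotent :
  serre (ess_image (cotensor_embedding_at D i i)) -> mono mu.
Proof.
move=> [_ _ ext]; have [_ ker coker _ _] := ab i i.
have piD := mono_kernel_of_cokernel (ab i i) (incl_mono (i := i)) Dpi.
pose f := mu \c pi; have [E [e fe]] := ker _ _ f; have em := kernel_mono fe.
have fD : fwd (asc J J (C i)) \c (f *** idm (C i)) \c comul C i =
    (idm J *** rho) \c f.
  rewrite /f rwhiskM -[LHS]compA -[X in _ \c X]compA -Erho [RHS]compA.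
  by rewrite -mu_comul !compA.
(* [r] is the coaction of [E], obtained by restricting [comul C i]. *)
have [|r Er] := kernel_factor (h := comul C i \c e) (kernel_rwhisk lex (C i) fe).
  have ascm : mono (fwd (asc J J (C i))).
    move=> z g h E'; rewrite -[g]comp1m -[h]comp1m -(bwdK (asc J J (C i))).
    by rewrite -!compA E'.
  by apply: (mono_eq0 ascm); rewrite !compA fD -compA fe.1 compm0.
pose cE := subcomod ab lex (M := regular_comodule C i) em (esym Er).
have fi : f \c incl D i = 0 by rewrite /f -compA Dpi.1 compm0.
have [d Ed] := kernel_factor fe fi.
pose cD := cores_ob (regular_comodule D i).
have [|d' Ed'] := @comod_hom_ex _ _ _ C _ _ cD cE d.
  apply: (mono_rwhisk ab lex (N := C i) em).
  rewrite /= /cores_coact /= compA Er -compA Ed incl_comul.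
  by rewrite [RHS]compA -rwhiskM Ed compA hc2_lr.
have [T [t dt]] := coker _ _ d; have te := cokernel_epi dt.
have [|rT ErT] := cokernel_factor (h := (t *** idm (C i)) \c r) dt.
  have := comod_homE d'; rewrite Ed' /= -compA => ->.
  by rewrite compA -rwhiskM dt.1 rwhisk0 comp0m.
pose cT := quocomod (M := cE) te ErT.
have [t' Et'] := quocomod_proj (M := cE) te ErT.
have [|s Es] := cokernel_factor (h := pi \c e) dt.
  by rewrite -compA Ed Dpi.1.
have dm : mono d.
  by move=> z g h E'; apply: (incl_mono (i := i)); rewrite -Ed -!compA E'.
(* [d] is the kernel of [pi \c e], so [s] is the induced map on a coimage. *)
have sm : mono s.
  apply: (coimage_mono (ab i i) _ dt (esym Es)); apply: is_kernelP => //.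
    by rewrite -compA Ed Dpi.1.
  move=> z h; rewrite -compA => /(kernel_factor piD)[v Ev].
  by exists v; apply: (em); rewrite compA Ed.
(* After [s *** id_J] and [t], the residue of [T] is [mu \c pi \c e]. *)
have rT0 : residue pi cT = 0.
  apply: (epi_eq0 (te)); apply: (mono_eq0 (mono_rwhisk ab lex (N := J) sm)).
  have piF : (idm J *** pi) \c (pi *** idm (C i)) \c comul C i \c e = 0.
    by rewrite -[X in X \c e]compA -Erho compA -/mu fe.1.
  rewrite /residue -compA /= ErT compA hc2_lr -hc2_rl compA -[X in X \c r]compA.
  rewrite -rwhiskM Es rwhiskM.
  by rewrite -!compA Er !compA piF.
have SE : ess_image (cotensor_embedding_at D i i) cE.
  apply: (ext cD cE cT d' t'); last exact/(ess_image_residue _ Dpi).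
    split.
      apply: kernel_comod => //; rewrite Ed' Et'.
      exact: mono_kernel_of_cokernel.
    by apply: cokernel_comod; rewrite Ed' Et'.
  exists (regular_comodule D i); split.
  by exists (idm _) (idm _); rewrite comp1m.
have rE0 : (idm E *** pi) \c r = 0 := (ess_image_residue cE Dpi).1 SE.
(* The counit recovers [pi \c e] from the residue of [E]. *)
have pie : pi \c e = 0.
  rewrite -[pi]compm1 -(counitl C i) !compA -lun_nat -!compA -Er /=.
  rewrite [(counit C i *** _) \c _]compA -rwhiskM.
  rewrite [(idm (id1 B i) *** pi) \c _]compA hc2_rl -hc2_lr -compA rE0.
  by rewrite !compm0.
apply: (coimage_mono (f := f) (ab i i) _ Dpi erefl).
apply: is_kernelP => // [|z h fh]; first exact: incl_mono.
have [h' Eh] := kernel_factor fe fh; apply: kernel_factor piD _.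
by rewrite -Eh compA pie comp0m.
Qed.

End Quotient.

End SubCoalgebra.

Theorem proposition16 (k : closedFieldType) (I : finType)
    (C Cb : bicat k I) (P : pseudofunctor C Cb)
    (hC : weakly_fiat C) (hP : injective_abelianisation P)
    (A : coalgebra Cb) (D : subcoalgebra A) :
  serre (ess_image (cotensor_embedding D)) <-> coidempotent D.
Proof.
have [abI _ _ lex] := hP.
have ab i j : abelian_cat (Cb i j) := (abI i j).1.
have serreP : serre (ess_image (cotensor_embedding D)) <->
    forall p : I * I, serre (ess_image (cotensor_embedding_at D p.1 p.2)).
  apply: iff_trans (serre_dsum _); last by move=> p; apply: ess_image_zero.
  by apply: eq_serre => M; apply: ess_image_dsum_fun.
apply: (iff_trans serreP); split=> [H i | H [i j]]; last first.
  by have [J [pi [rho [Dpi Erho mum]]]] := H i; apply: coidempotent_serre_at mum.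
have [_ _ coker _ _] := ab i i; have [J [pi Dpi]] := coker _ _ (incl D i).
have [|rho Erho] := cokernel_factor (h := (pi *** idm (A i)) \c comul A i) Dpi.
  rewrite -compA incl_comul compA -hc2_comp Dpi.1 comp1m -hc2_lr rwhisk0.
  by rewrite !comp0m.
exists J, pi, rho; split=> //; exact: serre_at_coidempotent (H (i, i)).
Qed.
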